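(* Let $(P_1,Q_1)\neq(P_2,Q_2)$ be non-degenerate integer pairs with $P_i>0$ and $|Q_i|=1$ ($i=1,2$). The following are equivalent: (i) the intersection $\{U_n(P_1,Q_1):n\ge0\}\cap\{U_n(P_2,Q_2):n\ge0\}$ is infinite; (ii) $P_1^2-4Q_1=P_2^2-4Q_2$; (iii) $\{(P_1,Q_1),(P_2,Q_2)\}=\{(1,-1),(3,1)\}$, i.e. the two sequences are the Fibonacci numbers $U_n(1,-1)$ and $U_n(3,1)=U_{2n}(1,-1)$. In that case the intersection equals $\{U_n(3,1):n\ge0\}$.
   Context: For integers $P,Q$, the Lucas sequences are defined by $U_0(P,Q)=0$, $U_1(P,Q)=1$, $V_0(P,Q)=2$, $V_1(P,Q)=P$, and for $n\ge1$: $U_{n+1}=P\,U_n-Q\,U_{n-1}$, $V_{n+1}=P\,V_n-Q\,V_{n-1}$. The discriminant of $(P,Q)$ is $P^2-4Q$. A pair $(P,Q)$ (and its sequences) is called degenerate if $(P,Q)\in\{(0,1),(0,-1),(1,1),(2,1)\}$, and non-degenerate otherwise. *)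

(* Defs.v *)
From Stdlib Require Import ZArith List.
Open Scope Z_scope.

Fixpoint lucasU_pair (P Q : Z) (n : nat) : Z * Z :=
  match n with
  | O => (0, 1)
  | S m => let (a, b) := lucasU_pair P Q m in (b, P * b - Q * a)
  end.

Definition lucasU (P Q : Z) (n : nat) : Z := fst (lucasU_pair P Q n).

Definition degenerate (P Q : Z) : Prop :=
  (P, Q) = (0, 1) \/ (P, Q) = (0, -1) \/ (P, Q) = (1, 1) \/ (P, Q) = (2, 1).

Definition inU (P Q x : Z) : Prop := exists n : nat, lucasU P Q n = x.

Definition infinite_Z (S : Z -> Prop) : Prop :=
  ~ exists l : list Z, forall x, S x -> In x l.

(* Main.v *)
Require Import Defs.
From Stdlib Require Import ZArith List.
From Stdlib Require Import Reals Lra Lia Psatz Classical.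
From Coquelicot Require Import Coquelicot.
Open Scope Z_scope.

(** Since [V_n^2 - D U_n^2 = 4 Q^n] with [D = P^2 - 4 Q], a common term [x] satisfies
    [D1 x^2 +- 4 = y^2] and [D2 x^2 +- 4 = z^2].  For [D1 <> D2] this system has finitely many
    solutions, by a Thue-type argument.  If [(x0, y0, z0)] is a large solution, the integers
    [u0 = D1 D2 x0^2], [u1 = D2 y0^2], [u2 = D1 z0^2] have bounded non-zero differences.  The integral
    of [(t^2 / ((u0 + t^2) (u1 + t^2) (u2 + t^2)))^n] over [t >= 0] is, by partial fractions, [PI/2]
    times a rational combination of [sqrt u0], [sqrt u1], [sqrt u2] with coefficients of size and
    denominator under control (it is the remainder of the Hermite-Pade approximation of three square
    roots).  The positive integrand bounds it from both sides.  With [M] of the size of the [u_j],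
    clearing denominators gives integers [|a_j| <= (C M)^n] for which [sum_j a_j sqrt u_j] is, up to
    factors [C^n], of exact order [M^(-2n)].  If [(x, y, z)] is another solution, replacing
    [sqrt D1], [sqrt D2] by [y/x], [z/x] turns [sqrt (D1 D2) x sum_j a_j sqrt u_j] into an integer.
    It cannot vanish if [x] is larger than about [M^(3n/2)], and must vanish if [x] is between about
    [M^n] and [M^(2n)].  For [M] large these windows cover all large [x], so there is no further
    large solution. *)

(** * Integrals over the half-line *)

Section Approximation.
Local Open Scope R_scope.

(* Integrals over the half-line [0, +oo), through a primitive and its limit along the integers. *)
Definition has_integral (f : R -> R) (l : R) : Prop :=
  exists F : R -> R, F 0 = 0 /\ (forall t, is_derive F t (f t)) /\
    is_lim_seq (fun n => F (INR n)) l.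

Lemma has_integral_ext (f g : R -> R) (l : R) :
  (forall t, f t = g t) -> has_integral f l -> has_integral g l.
Proof.
  intros Hfg (F & H0 & HF & Hl); exists F; split; [|split]; auto.
  intros t; rewrite <- Hfg; apply HF.
Qed.

Lemma has_integral_lin (f g : R -> R) (l m a b : R) :
  has_integral f l -> has_integral g m ->
  has_integral (fun t => a * f t + b * g t) (a * l + b * m).
Proof.
  intros (F & F0 & HF & Fl) (G & G0 & HG & Gl).
  exists (fun t => a * F t + b * G t); split; [|split].
  - rewrite F0, G0; ring.
  - intros t; apply (is_derive_plus (fun t => a * F t) (fun t => b * G t));
      apply is_derive_scal; auto.
  - apply (is_lim_seq_plus' (fun n => a * F (INR n)) (fun n => b * G (INR n))).
    + apply (is_lim_seq_scal_l (fun n => F (INR n)) a l), Fl.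
    + apply (is_lim_seq_scal_l (fun n => G (INR n)) b m), Gl.
Qed.

Lemma derive_increment (F f : R -> R) (a b c : R) :
  (forall t, is_derive F t (f t)) -> a <= b ->
  (forall t, a <= t <= b -> c <= f t) -> c * (b - a) <= F b - F a.
Proof.
  intros HF Hab Hc.
  destruct (MVT_gen F a b f) as (t & Ht & E).
  - intros; apply HF.
  - intros t _; apply continuity_pt_filterlim.
    apply (ex_derive_continuous F t); exists (f t); apply HF.
  - rewrite Rmin_left, Rmax_right in Ht by lra.
    rewrite E; apply Rmult_le_compat_r; [lra | auto].
Qed.

Lemma has_integral_le (f g : R -> R) (l m : R) :
  has_integral f l -> has_integral g m ->
  (forall t, 0 <= t -> f t <= g t) -> l <= m.
Proof.
  intros (F & F0 & HF & Fl) (G & G0 & HG & Gl) Hle.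
  apply (is_lim_seq_le (fun n => F (INR n)) (fun n => G (INR n)) l m); auto.
  intros n.
  assert (H : 0 * (INR n - 0) <= (G (INR n) - F (INR n)) - (G 0 - F 0)).
  { apply (derive_increment (fun t => G t - F t) (fun t => g t - f t)).
    - intros t; apply (is_derive_minus G F t (g t) (f t)); auto.
    - apply pos_INR.
    - intros t Ht; specialize (Hle t (proj1 Ht)); lra. }
  rewrite F0, G0 in H; lra.
Qed.

Lemma has_integral_ge (f : R -> R) (l a b c : R) :
  has_integral f l -> (forall t, 0 <= t -> 0 <= f t) -> 0 <= a <= b ->
  (forall t, a <= t <= b -> c <= f t) -> c * (b - a) <= l.
Proof.
  intros (F & F0 & HF & Fl) Hpos Hab Hc.
  apply (is_lim_seq_le_loc (fun _ => c * (b - a)) (fun n => F (INR n)) (c * (b - a)) l);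
    auto using is_lim_seq_const.
  destruct (nfloor_ex b) as (N & HN); [lra|].
  exists (S N); intros n Hn; apply le_INR in Hn; rewrite S_INR in Hn.
  pose proof (derive_increment F f a b c HF (proj2 Hab) Hc).
  assert (0 * (a - 0) <= F a - F 0)
    by (apply (derive_increment F f); intros; auto; [lra | apply Hpos; lra]).
  assert (0 * (INR n - b) <= F (INR n) - F b)
    by (apply (derive_increment F f); intros; auto; [lra | apply Hpos; lra]).
  lra.
Qed.

(** * Powers of [tau], whose integrals are rational multiples of [PI / 2 * sqrt u] *)

Definition tau (u t : R) : R := u / (u + t ^ 2).

Lemma tau_bounds (u t : R) : 0 < u -> 0 < tau u t <= 1.
Proof.
  intros Hu; unfold tau; pose proof (pow2_ge_0 t).
  split; [apply Rdiv_lt_0_compat; lra | apply Rle_div_l; lra].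
Qed.

(** [Binomial.C] is a quotient of real factorials, so integrality comes from Pascal's rule. *)
Lemma C_integer (n k : nat) : (k <= n)%nat -> exists z, Binomial.C n k = IZR z.
Proof.
  revert k; induction n as [|n IH]; intros k Hk.
  - replace k with 0%nat by lia; exists 1%Z; unfold Binomial.C; simpl; field.
  - destruct k as [|k].
    { exists 1%Z; unfold Binomial.C; rewrite Nat.sub_0_r; change (INR (fact 0)) with 1.
      field; apply INR_fact_neq_0. }
    destruct (Nat.eq_dec k n) as [->|Hne].
    { exists 1%Z; unfold Binomial.C; rewrite Nat.sub_diag; change (INR (fact 0)) with 1.
      field; apply INR_fact_neq_0. }
    destruct (IH k) as (z & Hz); [lia|]; destruct (IH (S k)) as (z' & Hz'); [lia|].
    exists (z + z')%Z; rewrite plus_IZR, <- Hz, <- Hz'; symmetry; apply pascal; lia.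
Qed.

Lemma central_binomial_rec (i : nat) :
  (INR i + 1) * Binomial.C (2 * S i) (S i) = 2 * (2 * INR i + 1) * Binomial.C (2 * i) i.
Proof.
  unfold Binomial.C.
  replace (2 * S i - S i)%nat with (S i) by lia.
  replace (2 * i - i)%nat with i by lia.
  replace (2 * S i)%nat with (S (S (2 * i))) by lia.
  rewrite 3!fact_simpl, !mult_INR, !S_INR, mult_INR; simpl (INR 2).
  pose proof (pos_INR i); pose proof (INR_fact_neq_0 i).
  field; split; [auto|lra].
Qed.

Lemma central_binomial_bounds (i : nat) : 0 < Binomial.C (2 * i) i <= 4 ^ i.
Proof.
  induction i as [|i IH]; [unfold Binomial.C; simpl; lra|].
  pose proof (central_binomial_rec i) as E; pose proof (pos_INR i).
  set (b := Binomial.C (2 * S i) (S i)) in *; set (a := Binomial.C (2 * i) i) in *; simpl pow.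
  nra.
Qed.

Lemma lim_div_INR (a : R) : is_lim_seq (fun n => a / INR n) 0.
Proof.
  replace 0 with (a * 0) by ring.
  apply (is_lim_seq_scal_l (fun n => / INR n) a 0).
  apply (is_lim_seq_inv INR p_infty); [apply is_lim_seq_INR | discriminate].
Qed.

(* From [(t tau^k)' = tau^k - 2k (tau^k - tau^(k+1))]; the boundary term vanishes at infinity. *)
Lemma integral_tau_pow (u : R) (i : nat) : 0 < u ->
  has_integral (fun t => tau u t ^ S i) (PI / 2 * (Binomial.C (2 * i) i / 4 ^ i * sqrt u)).
Proof.
  intros Hu; pose proof (sqrt_lt_R0 u Hu) as Hs.
  assert (Hss : sqrt u * sqrt u = u) by (apply sqrt_sqrt; lra).
  induction i as [|i (F & F0 & HF & Fl)].
  - exists (fun t => sqrt u * atan (t / sqrt u)); split; [|split].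
    + unfold Rdiv; rewrite Rmult_0_l, atan_0; ring.
    + intros t; auto_derive; auto.
      unfold tau; pose proof (pow2_ge_0 t); simpl pow in *.
      set (s := sqrt u) in *; rewrite <- Hss; field.
      split; nra.
    + replace (PI / 2 * (Binomial.C (2 * 0) 0 / 4 ^ 0 * sqrt u)) with (sqrt u * (PI / 2))
        by (unfold Binomial.C; simpl; field).
      apply (is_lim_seq_scal_l (fun n => atan (INR n / sqrt u)) (sqrt u) (PI / 2)).
      apply (is_lim_seq_ext_loc (fun n => PI / 2 - atan (sqrt u / INR n))).
      * exists 1%nat; intros n Hn; apply le_INR in Hn; simpl in Hn.
        assert (E : sqrt u / INR n = / (INR n / sqrt u)) by (field; lra).
        rewrite E, atan_inv by (apply Rdiv_lt_0_compat; lra); ring.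
      * replace (PI / 2) with (PI / 2 - atan 0) at 1 by (rewrite atan_0; ring).
        apply is_lim_seq_minus'; [apply is_lim_seq_const|].
        apply is_lim_seq_continuous;
          [apply derivable_continuous_pt, derivable_pt_atan | apply lim_div_INR].
  - assert (Hi := pos_INR i).
    exists (fun t => / (2 * (INR i + 1)) * (t * tau u t ^ S i)
                     + (2 * INR i + 1) / (2 * (INR i + 1)) * F t); split; [|split].
    + rewrite F0; ring.
    + intros t; pose proof (pow2_ge_0 t) as Ht.
      assert (H : is_derive (fun t => t * tau u t ^ S i) t
                (tau u t ^ S i * (1 - 2 * (INR i + 1) * (1 - tau u t)))).
      { unfold tau; auto_derive; [simpl pow in Ht; lra|].
        change (match i with 0%nat => 1 | S _ => INR i + 1 end) with (INR (S i)).
        rewrite S_INR; simpl pow in *; unfold Rdiv.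
        generalize ((u * / (u + t * (t * 1))) ^ i); intros p; field; lra. }
      replace (tau u t ^ S (S i)) with
        (/ (2 * (INR i + 1)) * (tau u t ^ S i * (1 - 2 * (INR i + 1) * (1 - tau u t)))
         + (2 * INR i + 1) / (2 * (INR i + 1)) * tau u t ^ S i)
        by (simpl pow; field; lra).
      apply (is_derive_plus (fun t => / (2 * (INR i + 1)) * (t * tau u t ^ S i))
               (fun t => (2 * INR i + 1) / (2 * (INR i + 1)) * F t));
        apply is_derive_scal; auto.
    + replace (PI / 2 * (Binomial.C (2 * S i) (S i) / 4 ^ S i * sqrt u)) with
        (/ (2 * (INR i + 1)) * 0 + (2 * INR i + 1) / (2 * (INR i + 1)) *
          (PI / 2 * (Binomial.C (2 * i) i / 4 ^ i * sqrt u))).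
      2:{ replace (Binomial.C (2 * S i) (S i)) with (2 * (2 * INR i + 1) * Binomial.C (2 * i) i / (INR i + 1))
            by (rewrite <- central_binomial_rec; field; lra).
          simpl pow; field; split; [lra | apply pow_nonzero; lra]. }
      apply is_lim_seq_plus'.
      2: apply (is_lim_seq_scal_l (fun n => F (INR n))
                  ((2 * INR i + 1) / (2 * (INR i + 1)))
                  (PI / 2 * (Binomial.C (2 * i) i / 4 ^ i * sqrt u))), Fl.
      apply (is_lim_seq_scal_l (fun n => INR n * tau u (INR n) ^ S i)
               (/ (2 * (INR i + 1))) 0).
      (* Since [tau <= 1] and [t * tau u t <= u / t], the boundary term is squeezed between 0 and
         [u / n]. *)
      apply (is_lim_seq_le_le_loc (fun _ => 0) _ (fun n => u / INR n));
        [|apply is_lim_seq_const|apply lim_div_INR].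
      exists 1%nat; intros n Hn; apply le_INR in Hn; simpl in Hn.
      destruct (tau_bounds u (INR n) Hu) as (H0 & H1).
      assert (0 <= tau u (INR n) ^ i <= 1)
        by (split; [apply pow_le; lra | rewrite <- (pow1 i); apply pow_incr; lra]).
      assert (tau u (INR n) * INR n <= u / INR n).
      { replace (u / INR n) with (u / (INR n ^ 2) * INR n) by (field; lra).
        apply Rmult_le_compat_r; [lra|]; unfold tau, Rdiv.
        apply Rmult_le_compat_l; [lra|]; apply Rinv_le_contravar; [nra|lra]. }
      set (T := tau u (INR n)) in *; simpl pow; split.
      * apply Rmult_le_pos; [lra|]; apply Rmult_le_pos; lra.
      * apply Rle_trans with (T * INR n); [|lra].
        assert (0 <= T * INR n) by nra; nra.
Qed.

(** * Partial fractions: integrals as combinations of three square roots, with common denominator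
    [c] and integer numerators bounded by [b] *)

Definition sqrt_integral (u0 u1 u2 : Z) (c b : R) (f : R -> R) : Prop :=
  exists a0 a1 a2 : Z,
    Rabs (IZR a0) <= b /\ Rabs (IZR a1) <= b /\ Rabs (IZR a2) <= b /\
    has_integral f (PI / 2 * ((IZR a0 * sqrt (IZR u0) + IZR a1 * sqrt (IZR u1)
                               + IZR a2 * sqrt (IZR u2)) / c)).

Lemma sqrt_integral_ext (u0 u1 u2 : Z) (c b : R) (f g : R -> R) :
  (forall t, f t = g t) -> sqrt_integral u0 u1 u2 c b f -> sqrt_integral u0 u1 u2 c b g.
Proof.
  intros Hfg (a0 & a1 & a2 & H0 & H1 & H2 & H); exists a0, a1, a2.
  repeat (split; [assumption|]); revert H; apply has_integral_ext, Hfg.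
Qed.

Lemma sqrt_integral_comb (u0 u1 u2 : Z) (c b1 b2 b : R) (f g : R -> R) (p q r : Z) :
  c <> 0 -> q <> 0%Z -> Rabs (IZR p) * b1 + Rabs (IZR r) * b2 <= b ->
  sqrt_integral u0 u1 u2 c b1 f -> sqrt_integral u0 u1 u2 c b2 g ->
  sqrt_integral u0 u1 u2 (IZR q * c) b
    (fun t => (IZR p * f t + IZR r * g t) / IZR q).
Proof.
  intros Hc Hq Hb (a0 & a1 & a2 & H0 & H1 & H2 & H) (c0 & c1 & c2 & K0 & K1 & K2 & K).
  apply not_0_IZR in Hq.
  assert (Hbound : forall a a' : Z, Rabs (IZR a) <= b1 -> Rabs (IZR a') <= b2 ->
            Rabs (IZR (p * a + r * a')) <= b).
  { intros a a' Ha Ha'; rewrite plus_IZR, !mult_IZR.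
    eapply Rle_trans; [apply Rabs_triang|]; rewrite !Rabs_mult.
    pose proof (Rabs_pos (IZR p)); pose proof (Rabs_pos (IZR r)); nra. }
  exists (p * a0 + r * c0)%Z, (p * a1 + r * c1)%Z, (p * a2 + r * c2)%Z.
  repeat (split; [apply Hbound; assumption|]).
  pose proof (has_integral_lin _ _ _ _ (IZR p / IZR q) (IZR r / IZR q) H K) as HL.
  match type of HL with has_integral _ ?l => match goal with |- has_integral _ ?m =>
    replace m with l end end.
  - revert HL; apply has_integral_ext; intros t; field; auto.
  - rewrite !plus_IZR, !mult_IZR; field; auto.
Qed.

(** The natural denominator is only [4 ^ d]. Numerator and denominator are padded by [D ^ d], so
    that all monomials of one degree share the same denominator and can be added. *)
Lemma sqrt_integral_tau_pow (u0 u1 u2 u D : Z) (K M : R) (d : nat) :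
  u = u0 \/ u = u1 \/ u = u2 -> (0 < u)%Z -> D <> 0%Z -> Rabs (IZR D) <= K -> 1 <= M ->
  sqrt_integral u0 u1 u2 (IZR (4 * D) ^ d) ((8 * K * M) ^ d) (fun t => tau (IZR u) t ^ S d).
Proof.
  intros Hu Hpos HD HK HM.
  destruct (C_integer (2 * d) d) as (z & Hz); [lia|].
  pose proof (central_binomial_bounds d) as Hb; rewrite Hz in Hb.
  pose proof (integral_tau_pow (IZR u) d (IZR_lt _ _ Hpos)) as HI; rewrite Hz in HI.
  assert (Hbound : Rabs (IZR (z * D ^ Z.of_nat d)) <= (8 * K * M) ^ d).
  { rewrite mult_IZR, Rabs_mult, <- pow_IZR, <- RPow_abs, (Rabs_pos_eq (IZR z)) by lra.
    apply Rle_trans with ((4 * K) ^ d).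
    - rewrite Rpow_mult_distr; pose proof (Rabs_pos (IZR D)).
      apply Rmult_le_compat; try lra; [apply pow_le; lra | apply pow_incr; lra].
    - pose proof (Rabs_pos (IZR D)); apply pow_incr; nra. }
  assert (H0 : Rabs (IZR 0) <= (8 * K * M) ^ d).
  { rewrite Rabs_R0; eapply Rle_trans; [apply Rabs_pos | apply Hbound]. }
  assert (HD' : IZR D ^ d <> 0) by (apply pow_nonzero, not_0_IZR, HD).
  assert (H4 : 4 ^ d <> 0) by (apply pow_nonzero; lra).
  destruct Hu as [-> | [-> | ->]];
    [ exists (z * D ^ Z.of_nat d)%Z, 0%Z, 0%Z | exists 0%Z, (z * D ^ Z.of_nat d)%Z, 0%Z
    | exists 0%Z, 0%Z, (z * D ^ Z.of_nat d)%Z ];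
    repeat (split; [assumption|]);
    match type of HI with has_integral _ ?l => match goal with |- has_integral _ ?m =>
      replace m with l; [exact HI|] end end;
    rewrite !mult_IZR, <- pow_IZR, Rpow_mult_distr; field; auto.
Qed.

Lemma tau_mul_tau (u v t : R) : 0 < u -> 0 < v -> u <> v ->
  tau u t * tau v t = (v * tau u t - u * tau v t) / (v - u).
Proof.
  intros Hu Hv Huv; unfold tau; pose proof (pow2_ge_0 t).
  field; repeat split; lra.
Qed.

(** One partial fraction step, lowering the degree by one. The true denominator [v - u] divides [D];
    multiplying by the cofactor [g] and by 4 makes it [4 * D]. The numerators [4 * g * v] and
    [4 * g * u] are at most [4 * K * M] in absolute value, whence the factor [8 * K * M]. *)
Lemma sqrt_integral_mul_pair (u0 u1 u2 u v g D : Z) (K M c b : R) (r : R -> R) :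
  (0 < u)%Z -> (0 < v)%Z -> IZR u <= M -> IZR v <= M ->
  ((v - u) * g)%Z = D -> D <> 0%Z -> Rabs (IZR D) <= K -> c <> 0 -> 0 <= b ->
  sqrt_integral u0 u1 u2 c b (fun t => tau (IZR u) t * r t) ->
  sqrt_integral u0 u1 u2 c b (fun t => tau (IZR v) t * r t) ->
  sqrt_integral u0 u1 u2 (IZR (4 * D) * c) (8 * K * M * b)
    (fun t => tau (IZR u) t * tau (IZR v) t * r t).
Proof.
  intros Hu Hv HuM HvM Hg HD HK Hc Hb H1 H2.
  assert (Hvu : (v - u)%Z <> 0%Z) by (intros E; rewrite E in Hg; lia).
  assert (Hg0 : g <> 0%Z) by (intros E; rewrite E in Hg; lia).
  assert (HgK : Rabs (IZR g) <= K).
  { eapply Rle_trans; [|exact HK]; rewrite <- !abs_IZR; apply IZR_le; subst D.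
    rewrite Z.abs_mul; nia. }
  apply IZR_lt in Hu; apply IZR_lt in Hv.
  assert (HuvR : IZR u <> IZR v) by (intros E; apply eq_IZR in E; lia).
  eapply sqrt_integral_ext;
    [| eapply sqrt_integral_comb with (p := (4 * g * v)%Z) (r := (- (4 * g * u))%Z);
       [exact Hc | | | exact H1 | exact H2]]; [| lia |].
  - intros t; cbv beta; rewrite tau_mul_tau by assumption.
    rewrite <- Hg, opp_IZR, !mult_IZR, minus_IZR.
    apply not_0_IZR in Hvu; apply not_0_IZR in Hg0; rewrite minus_IZR in Hvu.
    field; auto.
  - rewrite opp_IZR, Rabs_Ropp, !mult_IZR, !Rabs_mult.
    rewrite (Rabs_pos_eq 4), (Rabs_pos_eq (IZR u)), (Rabs_pos_eq (IZR v)) by lra.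
    rewrite <- Rmult_plus_distr_r; apply Rmult_le_compat_r; [lra|].
    pose proof (Rabs_pos (IZR g)); nra.
Qed.

(** Induction on the degree: pure powers are integrated directly, and a monomial with two different
    factors is reduced by a partial fraction step. [D] is the product of all differences, so it
    serves every pair. *)
Lemma sqrt_integral_monomial (u0 u1 u2 D : Z) (K M : R) :
  (0 < u0)%Z -> (0 < u1)%Z -> (0 < u2)%Z -> 1 <= M ->
  IZR u0 <= M -> IZR u1 <= M -> IZR u2 <= M ->
  D = ((u1 - u0) * (u2 - u0) * (u2 - u1))%Z -> D <> 0%Z -> Rabs (IZR D) <= K ->
  forall d k0 k1 k2 : nat, (k0 + k1 + k2 = S d)%nat ->
  sqrt_integral u0 u1 u2 (IZR (4 * D) ^ d) ((8 * K * M) ^ d)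
    (fun t => tau (IZR u0) t ^ k0 * tau (IZR u1) t ^ k1 * tau (IZR u2) t ^ k2).
Proof.
  intros Hu0 Hu1 Hu2 HM H0 H1 H2 HD HD0 HK.
  assert (HK0 : 0 <= K) by (eapply Rle_trans; [apply Rabs_pos|exact HK]).
  assert (Hpure : forall d u, u = u0 \/ u = u1 \/ u = u2 ->
    sqrt_integral u0 u1 u2 (IZR (4 * D) ^ d) ((8 * K * M) ^ d) (fun t => tau (IZR u) t ^ S d)).
  { intros d u Hu; apply sqrt_integral_tau_pow; auto; lia. }
  assert (Hc : forall d, IZR (4 * D) ^ d <> 0)
    by (intros d; apply pow_nonzero, not_0_IZR; lia).
  assert (Hb : forall d, 0 <= (8 * K * M) ^ d) by (intros d; apply pow_le; nra).
  assert (Hpair : forall d u v g r, (0 < u)%Z -> (0 < v)%Z -> IZR u <= M -> IZR v <= M ->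
    ((v - u) * g)%Z = D ->
    sqrt_integral u0 u1 u2 (IZR (4 * D) ^ d) ((8 * K * M) ^ d) (fun t => tau (IZR u) t * r t) ->
    sqrt_integral u0 u1 u2 (IZR (4 * D) ^ d) ((8 * K * M) ^ d) (fun t => tau (IZR v) t * r t) ->
    sqrt_integral u0 u1 u2 (IZR (4 * D) ^ S d) ((8 * K * M) ^ S d)
      (fun t => tau (IZR u) t * tau (IZR v) t * r t)).
  { intros d u v g r; intros; simpl pow; apply sqrt_integral_mul_pair with g; auto. }
  induction d as [|d IH]; intros k0 k1 k2 Hk.
  - destruct k0 as [|k0]; [destruct k1 as [|k1]|].
    + replace k2 with 1%nat by lia; eapply sqrt_integral_ext;
        [|apply (Hpure 0%nat u2); auto]; intros t; simpl; ring.
    + replace k1 with 0%nat by lia; replace k2 with 0%nat by lia; eapply sqrt_integral_ext;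
        [|apply (Hpure 0%nat u1); auto]; intros t; simpl; ring.
    + replace k0 with 0%nat by lia; replace k1 with 0%nat by lia; replace k2 with 0%nat by lia;
        eapply sqrt_integral_ext; [|apply (Hpure 0%nat u0); auto]; intros t; simpl; ring.
  - destruct k0 as [|k0]; [destruct k1 as [|k1]; [|destruct k2 as [|k2]] | destruct k1 as [|k1]].
    + replace k2 with (S (S d)) by lia; eapply sqrt_integral_ext;
        [|apply (Hpure (S d) u2); auto]; intros t; simpl; ring.
    + replace k1 with (S d) by lia; eapply sqrt_integral_ext;
        [|apply (Hpure (S d) u1); auto]; intros t; simpl; ring.
    + eapply sqrt_integral_ext; [|apply (Hpair d u1 u2 ((u1 - u0) * (u2 - u0))%Z
        (fun t => tau (IZR u1) t ^ k1 * tau (IZR u2) t ^ k2)); auto; [subst D; ring| |]].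
      * intros t; simpl; ring.
      * eapply sqrt_integral_ext; [|apply (IH 0 (S k1) k2)%nat; lia]; intros t; simpl; ring.
      * eapply sqrt_integral_ext; [|apply (IH 0 k1 (S k2))%nat; lia]; intros t; simpl; ring.
    + destruct k2 as [|k2].
      * replace k0 with (S d) by lia; eapply sqrt_integral_ext;
          [|apply (Hpure (S d) u0); auto]; intros t; simpl; ring.
      * eapply sqrt_integral_ext; [|apply (Hpair d u0 u2 ((u1 - u0) * (u2 - u1))%Z
          (fun t => tau (IZR u0) t ^ k0 * tau (IZR u2) t ^ k2)); auto; [subst D; ring| |]].
        -- intros t; simpl; ring.
        -- eapply sqrt_integral_ext; [|apply (IH (S k0) 0 k2)%nat; lia]; intros t; simpl; ring.
        -- eapply sqrt_integral_ext; [|apply (IH k0 0 (S k2))%nat; lia]; intros t; simpl; ring.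
    + eapply sqrt_integral_ext; [|apply (Hpair d u0 u1 ((u2 - u0) * (u2 - u1))%Z
        (fun t => tau (IZR u0) t ^ k0 * tau (IZR u1) t ^ k1 * tau (IZR u2) t ^ k2)); auto;
        [subst D; ring| |]].
      * intros t; simpl; ring.
      * eapply sqrt_integral_ext; [|apply (IH (S k0) k1 k2)%nat; lia]; intros t; simpl; ring.
      * eapply sqrt_integral_ext; [|apply (IH k0 (S k1) k2)%nat; lia]; intros t; simpl; ring.
Qed.

(** * The kernel and the small linear form in square roots *)

Definition kernel (u0 u1 u2 t : R) : R :=
  t ^ 2 / ((u0 + t ^ 2) * (u1 + t ^ 2) * (u2 + t ^ 2)).

(** The factor [t ^ 2] supplies the numerators of the [tau]'s, so that the coefficients involve only
    differences of the [u_j] and stay bounded when the [u_j] grow. *)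
Lemma kernel_tau (u0 u1 u2 t : R) :
  0 < u0 -> 0 < u1 -> 0 < u2 -> u0 <> u1 -> u0 <> u2 -> u1 <> u2 ->
  kernel u0 u1 u2 t =
    ((u1 - u2) * tau u0 t + (u2 - u0) * tau u1 t + (u0 - u1) * tau u2 t)
      / ((u1 - u0) * (u2 - u0) * (u2 - u1)).
Proof.
  intros; unfold kernel, tau; pose proof (pow2_ge_0 t); field; repeat split; lra.
Qed.

(* Each factor [kernel] is expanded into [tau]'s, so the total degree [S d], hence the number of
   partial fraction steps, is bounded by the number of factors; this keeps the denominators
   geometric in [d]. *)
Lemma sqrt_integral_kernel_monomial (u0 u1 u2 D : Z) (K M : R) :
  (0 < u0)%Z -> (0 < u1)%Z -> (0 < u2)%Z -> 1 <= M ->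
  IZR u0 <= M -> IZR u1 <= M -> IZR u2 <= M ->
  D = ((u1 - u0) * (u2 - u0) * (u2 - u1))%Z -> D <> 0%Z -> Rabs (IZR D) <= K ->
  forall d n k0 k1 k2 : nat, (n + k0 + k1 + k2 = S d)%nat ->
  sqrt_integral u0 u1 u2 (IZR D ^ n * IZR (4 * D) ^ d) ((3 * K) ^ n * (8 * K * M) ^ d)
    (fun t => kernel (IZR u0) (IZR u1) (IZR u2) t ^ n *
      (tau (IZR u0) t ^ k0 * tau (IZR u1) t ^ k1 * tau (IZR u2) t ^ k2)).
Proof.
  intros Hu0 Hu1 Hu2 HM H0 H1 H2 HD HD0 HK d.
  induction n as [|n IH]; intros k0 k1 k2 Hk.
  - pose proof (sqrt_integral_monomial u0 u1 u2 D K M Hu0 Hu1 Hu2 HM H0 H1 H2 HD HD0 HK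
                  d k0 k1 k2 Hk) as H.
    simpl; rewrite !Rmult_1_l; revert H; apply sqrt_integral_ext; intros; ring.
  - set (b := (3 * K) ^ n * (8 * K * M) ^ d) in *.
    set (c := IZR D ^ n * IZR (4 * D) ^ d) in *.
    (* The three terms of [kernel_tau] are combined in two steps, the inner one with denominator 1;
       the bounds [2 * K * b] and [K * b] add up to [3 * K * b]. *)
    replace (IZR D ^ S n * IZR (4 * D) ^ d) with (IZR D * (IZR 1 * c)) by (unfold c; simpl; ring).
    assert (HK0 : 0 <= K) by (eapply Rle_trans; [apply Rabs_pos|exact HK]).
    assert (Hb : 0 <= b) by (apply Rmult_le_pos; apply pow_le; nra).
    assert (Hc : c <> 0)
      by (apply Rmult_integral_contrapositive_currified; apply pow_nonzero, not_0_IZR; lia).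
    assert (Hdvd : forall g h, (g * h)%Z = D -> Rabs (IZR g) <= K).
    { intros g h E; eapply Rle_trans; [|exact HK]; rewrite <- !abs_IZR; apply IZR_le.
      assert (h <> 0%Z) by (intros ->; lia).
      rewrite <- E, Z.abs_mul; nia. }
    assert (B0 : Rabs (IZR (u1 - u2)) <= K)
      by (apply (Hdvd _ (- ((u1 - u0) * (u2 - u0)))%Z); subst D; ring).
    assert (B1 : Rabs (IZR (u2 - u0)) <= K)
      by (apply (Hdvd _ ((u1 - u0) * (u2 - u1))%Z); subst D; ring).
    assert (B2 : Rabs (IZR (u0 - u1)) <= K)
      by (apply (Hdvd _ (- ((u2 - u0) * (u2 - u1)))%Z); subst D; ring).
    eapply sqrt_integral_ext;
      [| eapply sqrt_integral_comb with (p := 1%Z) (q := D) (r := (u0 - u1)%Z)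
           (b1 := 2 * K * b) (b2 := b);
         [ lra | exact HD0 | |
         | rewrite Rmult_1_l; apply (IH k0 k1 (S k2)); lia ]].
    2:{ rewrite Rabs_R1; simpl pow; fold b.
        replace (3 * K * (3 * K) ^ n * (8 * K * M) ^ d) with (3 * K * b) by (unfold b; ring).
        pose proof (Rabs_pos (IZR (u0 - u1))); nra. }
    2:{ eapply sqrt_integral_comb with (p := (u1 - u2)%Z) (q := 1%Z) (r := (u2 - u0)%Z)
           (b1 := b) (b2 := b);
         [ exact Hc | discriminate | | apply (IH (S k0) k1 k2); lia
         | apply (IH k0 (S k1) k2); lia ].
        nra. }
    intros t; cbv beta.
    assert (Hne : forall u v h, ((u - v) * h)%Z = D -> IZR v <> IZR u)
      by (intros u v h E F; apply eq_IZR in F; subst v; rewrite Z.sub_diag in E; lia).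
    assert (IZR u0 <> IZR u1) by (apply (Hne _ _ ((u2 - u0) * (u2 - u1))%Z); subst D; ring).
    assert (IZR u0 <> IZR u2) by (apply (Hne _ _ ((u1 - u0) * (u2 - u1))%Z); subst D; ring).
    assert (IZR u1 <> IZR u2) by (apply (Hne _ _ ((u1 - u0) * (u2 - u0))%Z); subst D; ring).
    apply IZR_lt in Hu0; apply IZR_lt in Hu1; apply IZR_lt in Hu2.
    rewrite <- !tech_pow_Rmult.
    generalize (kernel (IZR u0) (IZR u1) (IZR u2) t ^ n); intros.
    rewrite kernel_tau, HD, !mult_IZR, !minus_IZR by auto.
    generalize (tau (IZR u0) t), (tau (IZR u1) t), (tau (IZR u2) t),
      (tau (IZR u0) t ^ k0), (tau (IZR u1) t ^ k1), (tau (IZR u2) t ^ k2); intros.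
    field; repeat split; lra.
Qed.

(** Below: for [t] between [sqrt M] and [2 * sqrt M] the numerator is at least [M] and each
    denominator factor at most [5 * M]; this interval has length at least 1, and [PI / 2 <= 2].
    Above: [d] factors are bounded by [4 / M ^ 2], and the last one by [1 / (1 + t ^ 2)], which has
    integral [PI / 2]. *)
Lemma kernel_integral_bounds (u0 u1 u2 M r : R) (d : nat) :
  1 <= u0 <= M -> 1 <= u1 <= M -> 1 <= u2 <= M ->
  M <= 2 * u0 -> M <= 2 * u1 -> M <= 2 * u2 ->
  has_integral (fun t => kernel u0 u1 u2 t ^ S d) (PI / 2 * r) ->
  / 2 * (/ (125 * M ^ 2)) ^ S d <= r <= (4 / M ^ 2) ^ d.
Proof.
  intros H0 H1 H2 G0 G1 G2 HI.
  pose proof PI_RGT_0; pose proof PI_4.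
  assert (Hpos : forall t, 0 <= kernel u0 u1 u2 t).
  { intros t; pose proof (pow2_ge_0 t); unfold kernel; apply Rdiv_le_0_compat; [lra|].
    repeat apply Rmult_lt_0_compat; lra. }
  split.
  - assert (Hs : sqrt M * sqrt M = M) by (apply sqrt_sqrt; lra).
    assert (Hs1 : 1 <= sqrt M) by (rewrite <- sqrt_1; apply sqrt_le_1; lra).
    set (c := (/ (125 * M ^ 2)) ^ S d).
    assert (Hc : 0 < c) by (apply pow_lt, Rinv_0_lt_compat; nra).
    assert (c * (2 * sqrt M - sqrt M) <= PI / 2 * r).
    { apply (has_integral_ge _ _ (sqrt M) (2 * sqrt M) c HI); [|lra|].
      - intros t _; apply pow_le, Hpos.
      - intros t Ht; apply pow_incr; split; [left; apply Rinv_0_lt_compat; nra|].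
        assert (M <= t ^ 2 <= 4 * M) by nra.
        unfold kernel; apply Rle_div_r; [repeat apply Rmult_lt_0_compat; lra|].
        apply Rle_trans with (/ (125 * M ^ 2) * (5 * M * (5 * M) * (5 * M))).
        + apply Rmult_le_compat_l; [left; apply Rinv_0_lt_compat; nra|].
          apply Rmult_le_compat; try lra; [nra|]; apply Rmult_le_compat; lra.
        + replace (/ (125 * M ^ 2) * (5 * M * (5 * M) * (5 * M))) with M by (field; lra).
          lra. }
    nra.
  - pose proof (integral_tau_pow 1 0 Rlt_0_1) as HT.
    set (c := (4 / M ^ 2) ^ d).
    assert (Hc : 0 <= c) by (apply pow_le, Rdiv_le_0_compat; nra).
    pose proof (has_integral_lin _ _ _ _ c 0 HT HT) as HL.
    assert (PI / 2 * r <= c * (PI / 2)).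
    { replace (c * (PI / 2)) with
        (c * (PI / 2 * (Binomial.C (2 * 0) 0 / 4 ^ 0 * sqrt 1))
         + 0 * (PI / 2 * (Binomial.C (2 * 0) 0 / 4 ^ 0 * sqrt 1)))
        by (rewrite sqrt_1; unfold Binomial.C; simpl; field).
      apply (has_integral_le _ _ _ _ HI HL); intros t _.
      rewrite Rmult_0_l, Rplus_0_r; simpl (_ ^ S _); rewrite Rmult_1_r, Rmult_comm.
      pose proof (pow2_ge_0 t).
      apply Rmult_le_compat; auto; [apply pow_le; auto| |].
      - apply pow_incr; split; auto.
        unfold kernel; apply Rle_div_l; [repeat apply Rmult_lt_0_compat; lra|].
        apply Rle_trans with (4 / M ^ 2 * (M / 2 * (M / 2) * t ^ 2)).
        + right; field; lra.
        + apply Rmult_le_compat_l; [apply Rdiv_le_0_compat; nra|].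
          apply Rmult_le_compat; try nra; apply Rmult_le_compat; lra.
      - unfold kernel, tau; apply Rle_div_l; [repeat apply Rmult_lt_0_compat; lra|].
        rewrite Rmult_comm; apply Rle_trans with ((1 * (1 + t ^ 2) * t ^ 2) * (1 / (1 + t ^ 2))).
        + right; field; lra.
        + apply Rmult_le_compat_r; [apply Rdiv_le_0_compat; lra|].
          apply Rmult_le_compat; try nra. }
    nra.
Qed.

(** The [n]-th power of the kernel is integrated and its denominator [c] cleared, where
    [1 <= |c| <= (4 * K ^ 2) ^ n]. The extra [M ^ 2] in the upper bound pays for the kernel factor
    that was spent on convergence. *)
Lemma small_sqrt_form (u0 u1 u2 D : Z) (K M : R) (n : nat) :
  1 <= IZR u0 <= M -> 1 <= IZR u1 <= M -> 1 <= IZR u2 <= M ->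
  M <= 2 * IZR u0 -> M <= 2 * IZR u1 -> M <= 2 * IZR u2 ->
  D = ((u1 - u0) * (u2 - u0) * (u2 - u1))%Z -> D <> 0%Z -> Rabs (IZR D) <= K ->
  (0 < n)%nat ->
  exists a0 a1 a2 : Z,
    Rabs (IZR a0) <= (24 * K ^ 2 * M) ^ n /\ Rabs (IZR a1) <= (24 * K ^ 2 * M) ^ n /\
    Rabs (IZR a2) <= (24 * K ^ 2 * M) ^ n /\
    / 2 * (/ (125 * M ^ 2)) ^ n
      <= Rabs (IZR a0 * sqrt (IZR u0) + IZR a1 * sqrt (IZR u1) + IZR a2 * sqrt (IZR u2))
      <= M ^ 2 * (16 * K ^ 2 / M ^ 2) ^ n.
Proof.
  intros H0 H1 H2 G0 G1 G2 HD HD0 HK Hn.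
  destruct n as [|d]; [lia|].
  assert (HD1 : 1 <= Rabs (IZR D)) by (rewrite <- abs_IZR; apply IZR_le; lia).
  assert (P0 : (0 < u0)%Z) by (apply lt_IZR; lra).
  assert (P1 : (0 < u1)%Z) by (apply lt_IZR; lra).
  assert (P2 : (0 < u2)%Z) by (apply lt_IZR; lra).
  destruct (sqrt_integral_kernel_monomial u0 u1 u2 D K M P0 P1 P2 ltac:(lra)
    (proj2 H0) (proj2 H1) (proj2 H2) HD HD0 HK d (S d) 0 0 0 ltac:(lia))
    as (a0 & a1 & a2 & B0 & B1 & B2 & HI).
  set (A := (24 * K ^ 2 * M) ^ S d).
  assert (HA : (3 * K) ^ S d * (8 * K * M) ^ d <= A).
  { unfold A; replace (24 * K ^ 2 * M) with ((3 * K) * (8 * K * M)) by ring.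
    rewrite (Rpow_mult_distr (3 * K)); apply Rmult_le_compat_l; [apply pow_le; lra|].
    apply Rle_pow; [nra | lia]. }
  exists a0, a1, a2; repeat (split; [lra|]).
  set (g := IZR a0 * sqrt (IZR u0) + IZR a1 * sqrt (IZR u1) + IZR a2 * sqrt (IZR u2)) in *.
  set (c := IZR D ^ S d * IZR (4 * D) ^ d) in *.
  assert (Hc : 1 <= Rabs c <= (4 * K ^ 2) ^ S d).
  { unfold c; rewrite Rabs_mult, <- !RPow_abs, mult_IZR, Rabs_mult, (Rabs_pos_eq 4) by lra.
    split.
    - rewrite <- (Rmult_1_l 1); apply Rmult_le_compat; try lra; apply pow_R1_Rle; lra.
    - replace (4 * K ^ 2) with (K * (4 * K)) by ring; rewrite (Rpow_mult_distr K).
      apply Rmult_le_compat; try (apply pow_le; lra); [apply pow_incr; lra|].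
      apply Rle_trans with ((4 * K) ^ d); [apply pow_incr; lra | apply Rle_pow; [lra|lia]]. }
  assert (Hc0 : c <> 0) by (intros E; rewrite E, Rabs_R0 in Hc; lra).
  assert (Hr : / 2 * (/ (125 * M ^ 2)) ^ S d <= g / c <= (4 / M ^ 2) ^ d).
  { apply (kernel_integral_bounds (IZR u0) (IZR u1) (IZR u2)); auto.
    revert HI; apply has_integral_ext; intros; rewrite !pow_O; ring. }
  assert (Hlow : 0 < / 2 * (/ (125 * M ^ 2)) ^ S d)
    by (apply Rmult_lt_0_compat; [lra | apply pow_lt, Rinv_0_lt_compat; nra]).
  assert (Hg : Rabs g = g / c * Rabs c).
  { rewrite <- (Rabs_pos_eq (g / c)) by lra; rewrite <- Rabs_mult; f_equal; field; auto. }
  rewrite Hg; split; [nra|].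
  apply Rle_trans with ((4 / M ^ 2) ^ d * (4 * K ^ 2) ^ S d);
    [apply Rmult_le_compat; lra|].
  replace (16 * K ^ 2 / M ^ 2) with ((4 / M ^ 2) * (4 * K ^ 2)) by (field; lra).
  rewrite (Rpow_mult_distr (4 / M ^ 2)), <- Rmult_assoc.
  apply Rmult_le_compat_r; [apply pow_le; nra|].
  rewrite <- (tech_pow_Rmult _ d), <- Rmult_assoc.
  replace (M ^ 2 * (4 / M ^ 2)) with 4 by (field; lra).
  assert (0 <= (4 / M ^ 2) ^ d) by (apply pow_le, Rdiv_le_0_compat; nra); lra.
Qed.

(** * Two solutions of the simultaneous Pell equations *)

Lemma sqrt_approx (D e x y : Z) :
  (0 < D)%Z -> (0 < x)%Z -> (0 <= y)%Z -> Z.abs e = 4%Z -> (D * x ^ 2 + e = y ^ 2)%Z ->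
  Rabs (IZR y - sqrt (IZR D) * IZR x) <= 4 / IZR x.
Proof.
  intros HD Hx Hy He E.
  assert (HDR : 1 <= IZR D) by (apply IZR_le; lia).
  apply IZR_lt in Hx; apply IZR_le in Hy.
  assert (Hs : sqrt (IZR D) * sqrt (IZR D) = IZR D) by (apply sqrt_sqrt; lra).
  assert (Hs1 : 1 <= sqrt (IZR D)) by (rewrite <- sqrt_1; apply sqrt_le_1; lra).
  assert (ER : IZR D * IZR x ^ 2 + IZR e = IZR y ^ 2)
    by (rewrite !pow_IZR, <- mult_IZR, <- plus_IZR; f_equal; exact E).
  assert (HeR : Rabs (IZR e) = 4) by (rewrite <- abs_IZR, He; reflexivity).
  set (s := sqrt (IZR D)) in *; apply Rle_div_r; [exact Hx|].
  rewrite <- HeR.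
  (* The second factor [y + s * x] is at least [x]. *)
  replace (IZR e) with ((IZR y - s * IZR x) * (IZR y + s * IZR x)) by (rewrite <- Hs in ER; lra).
  rewrite Rabs_mult; apply Rmult_le_compat_l; [apply Rabs_pos|].
  rewrite Rabs_pos_eq; nra.
Qed.

Lemma sqrt_mul_sqr (D x : Z) : (0 <= D)%Z -> (0 <= x)%Z ->
  sqrt (IZR (D * x ^ 2)) = sqrt (IZR D) * IZR x.
Proof.
  intros HD Hx; apply IZR_le in HD; apply IZR_le in Hx.
  replace (IZR (D * x ^ 2)) with (IZR D * IZR x ^ 2)
    by (rewrite pow_IZR, <- mult_IZR; reflexivity).
  rewrite sqrt_mult, sqrt_pow2; auto using pow2_ge_0.
Qed.

(* [(x0, y0, z0)] is the solution the square roots are expanded at, [(x, y, z)] the one to exclude.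
   The integer [T] of the proof is either zero, giving the second alternative, or at least [1] in
   absolute value, giving the first or the third. *)
Lemma pell_window (D1 D2 x0 y0 z0 e1 e2 x y z f1 f2 : Z) (K M : R) (n : nat) :
  (0 < D1)%Z -> (0 < D2)%Z -> D1 <> D2 ->
  (0 < x0)%Z -> (0 <= y0)%Z -> (0 <= z0)%Z -> Z.abs e1 = 4%Z -> Z.abs e2 = 4%Z ->
  (D1 * x0 ^ 2 + e1 = y0 ^ 2)%Z -> (D2 * x0 ^ 2 + e2 = z0 ^ 2)%Z ->
  (0 < x)%Z -> (0 <= y)%Z -> (0 <= z)%Z -> Z.abs f1 = 4%Z -> Z.abs f2 = 4%Z ->
  (D1 * x ^ 2 + f1 = y ^ 2)%Z -> (D2 * x ^ 2 + f2 = z ^ 2)%Z ->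
  K = IZR (64 * D1 * D2 * (D1 + D2)) -> M = IZR (D1 * D2 * x0 ^ 2 + 4 * (D1 + D2)) ->
  (12 * (D1 + D2) <= D1 * D2 * x0 ^ 2)%Z -> (0 < n)%nat ->
  IZR x <= 16 * M * (24 * K ^ 2 * M) ^ n \/
  IZR x ^ 2 <= 16 * M * (3000 * K ^ 2 * M ^ 3) ^ n \/
  1 <= 2 * IZR (D1 * D2) * IZR x * (M ^ 2 * (16 * K ^ 2 / M ^ 2) ^ n).
Proof.
  intros HD1 HD2 HD12 Hx0 Hy0 Hz0 He1 He2 E1 E2 Hx Hy Hz Hf1 Hf2 F1 F2 HK HM Hlarge Hn.
  assert (N1 : (0 <= D1)%Z) by (apply Z.lt_le_incl, HD1).
  assert (N2 : (0 <= D2)%Z) by (apply Z.lt_le_incl, HD2).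
  assert (R1 : 1 <= IZR D1) by (apply IZR_le; clear - HD1; lia).
  assert (R2 : 1 <= IZR D2) by (apply IZR_le; clear - HD2; lia).
  assert (S0 : sqrt (IZR (D1 * D2 * x0 ^ 2)) = sqrt (IZR D1) * sqrt (IZR D2) * IZR x0).
  { rewrite sqrt_mul_sqr, mult_IZR, sqrt_mult; auto using Z.lt_le_incl, Z.mul_nonneg_nonneg; lra. }
  pose proof (sqrt_mul_sqr D2 y0 N2 Hy0) as S1.
  pose proof (sqrt_mul_sqr D1 z0 N1 Hz0) as S2.
  assert (My : (0 <= D2 * y0 <= D2 * y0 ^ 2)%Z) by (clear - N2 Hy0; nia).
  assert (Mz : (0 <= D1 * z0 <= D1 * z0 ^ 2)%Z) by (clear - N1 Hz0; nia).
  set (u0 := (D1 * D2 * x0 ^ 2)%Z) in *.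
  assert (U1 : (D2 * y0 ^ 2 = u0 + D2 * e1)%Z) by (rewrite <- E1; unfold u0; ring).
  assert (U2 : (D1 * z0 ^ 2 = u0 + D1 * e2)%Z) by (rewrite <- E2; unfold u0; ring).
  set (u1 := (D2 * y0 ^ 2)%Z) in *; set (u2 := (D1 * z0 ^ 2)%Z) in *.
  set (D := ((u1 - u0) * (u2 - u0) * (u2 - u1))%Z).
  (* The differences of the [u_j] do not involve [x0], so [K] depends on [D1] and [D2] only. *)
  assert (HD : D = (D2 * e1 * (D1 * e2) * (D1 * e2 - D2 * e1))%Z)
    by (unfold D; rewrite U1, U2; ring).
  assert (He1' : e1 = 4%Z \/ e1 = (-4)%Z) by (clear - He1; lia).
  assert (He2' : e2 = 4%Z \/ e2 = (-4)%Z) by (clear - He2; lia).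
  (* The value is [4 * |D1 - D2|] if [e1 = e2], and [4 * (D1 + D2)] otherwise; non-vanishing uses
     [D1 <> D2]. *)
  assert (Hdiff : (0 < Z.abs (D1 * e2 - D2 * e1) <= 4 * (D1 + D2))%Z)
    by (clear - HD1 HD2 HD12 He1' He2';
        destruct He1' as [-> | ->]; destruct He2' as [-> | ->]; lia).
  assert (HD0 : D <> 0%Z).
  { rewrite HD; clear - HD1 HD2 He1 He2 Hdiff.
    repeat (apply Z.neq_mul_0; split); lia. }
  assert (HDK : Rabs (IZR D) <= K).
  { rewrite HK, <- abs_IZR; apply IZR_le; rewrite HD, !Z.abs_mul, He1, He2.
    clear - HD1 HD2 Hdiff.
    rewrite (Z.abs_eq D1), (Z.abs_eq D2) by lia.
    assert (0 < D1 * D2)%Z by nia; nia. }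
  (* All [u_j] lie within [4 * (D1 + D2)] of [u0], so [M <= 2 * u] follows from
     [u0 >= 12 * (D1 + D2)]. *)
  assert (Hu : forall u, u = u0 \/ u = u1 \/ u = u2 -> 1 <= IZR u <= M /\ M <= 2 * IZR u).
  { intros u Hu.
    assert (u0 - 4 * (D1 + D2) <= u <= u0 + 4 * (D1 + D2))%Z
      by (clearbody u0; rewrite U1, U2 in Hu; clear - Hu HD1 HD2 He1' He2';
          destruct He1' as [-> | ->]; destruct He2' as [-> | ->]; lia).
    rewrite HM, <- mult_IZR; clearbody u0; clear - H Hlarge HD1 HD2.
    repeat split; apply IZR_le; lia. }
  destruct (Hu u0) as [A0 G0]; [auto|]; destruct (Hu u1) as [A1 G1]; [auto|];
    destruct (Hu u2) as [A2 G2]; [auto|]; clear Hu.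
  destruct (small_sqrt_form u0 u1 u2 D K M n A0 A1 A2 G0 G1 G2 eq_refl HD0 HDK Hn)
    as (a0 & a1 & a2 & _ & B1 & B2 & BL & BU).
  set (A := (24 * K ^ 2 * M) ^ n) in *.
  pose proof (sqrt_approx D1 f1 x y HD1 Hx Hy Hf1 F1) as Y.
  pose proof (sqrt_approx D2 f2 x z HD2 Hx Hz Hf2 F2) as Z'.
  assert (Hs1 : sqrt (IZR D1) * sqrt (IZR D1) = IZR D1) by (apply sqrt_sqrt; lra).
  assert (Hs2 : sqrt (IZR D2) * sqrt (IZR D2) = IZR D2) by (apply sqrt_sqrt; lra).
  assert (Ls1 : 1 <= sqrt (IZR D1)) by (rewrite <- sqrt_1; apply sqrt_le_1; lra).
  assert (Ls2 : 1 <= sqrt (IZR D2)) by (rewrite <- sqrt_1; apply sqrt_le_1; lra).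
  rewrite S0, S1, S2 in BL, BU.
  set (s1 := sqrt (IZR D1)) in *; set (s2 := sqrt (IZR D2)) in *.
  set (g := IZR a0 * (s1 * s2 * IZR x0) + IZR a1 * (s2 * IZR y0) + IZR a2 * (s1 * IZR z0)) in *.
  (* [T] is [s1 * s2 * x * g] with [s1 * x] replaced by [y] and [s2 * x] by [z]. *)
  set (T := (D1 * D2 * a0 * x0 * x + D2 * a1 * y0 * y + D1 * a2 * z0 * z)%Z).
  apply IZR_lt in Hx.
  assert (My' : 0 <= IZR (D2 * y0) <= M)
    by (destruct My as [My1 My2]; apply IZR_le in My1, My2; fold u1 in My2; lra).
  assert (Mz' : 0 <= IZR (D1 * z0) <= M)
    by (destruct Mz as [Mz1 Mz2]; apply IZR_le in Mz1, Mz2; fold u2 in Mz2; lra).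
  assert (HT : Rabs (IZR T - s1 * s2 * IZR x * g) <= 8 * M * A / IZR x).
  { replace (IZR T - s1 * s2 * IZR x * g) with
      (IZR (D2 * y0) * IZR a1 * (IZR y - s1 * IZR x)
       + IZR (D1 * z0) * IZR a2 * (IZR z - s2 * IZR x)).
    2:{ unfold T, g; rewrite !plus_IZR, !mult_IZR, <- Hs1, <- Hs2; ring. }
    eapply Rle_trans; [apply Rabs_triang|]; rewrite !Rabs_mult.
    rewrite (Rabs_pos_eq (IZR (D2 * y0))), (Rabs_pos_eq (IZR (D1 * z0))) by lra.
    replace (8 * M * A / IZR x) with (M * A * (4 / IZR x) + M * A * (4 / IZR x)) by (field; lra).
    apply Rplus_le_compat; apply Rmult_le_compat; auto using Rabs_pos;
      try (apply Rmult_le_pos; [lra | apply Rabs_pos]);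
      apply Rmult_le_compat; try lra; apply Rabs_pos. }
  assert (HA : 0 <= A) by (eapply Rle_trans; [apply Rabs_pos | exact B1]).
  destruct (Z.eq_dec T 0) as [T0|T0].
  (* If [T = 0], the approximation error bounds [s1 * s2 * x * |g|] itself, and the lower bound for
     [|g|] then limits [x ^ 2]. *)
  - right; left.
    rewrite T0, Rminus_0_l, Rabs_Ropp, !Rabs_mult in HT.
    rewrite (Rabs_pos_eq s1), (Rabs_pos_eq s2), (Rabs_pos_eq (IZR x)) in HT by lra.
    set (L := (/ (125 * M ^ 2)) ^ n) in *.
    assert (HL : L * (125 * M ^ 2) ^ n = 1).
    { unfold L; rewrite <- Rpow_mult_distr, Rinv_l, pow1; [reflexivity | nra]. }
    assert (HL0 : 0 < (125 * M ^ 2) ^ n) by (apply pow_lt; nra).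
    assert (HL1 : 0 < L) by (apply pow_lt, Rinv_0_lt_compat; nra).
    replace (3000 * K ^ 2 * M ^ 3) with (24 * K ^ 2 * M * (125 * M ^ 2)) by ring.
    rewrite Rpow_mult_distr; fold A.
    assert (IZR x * (/ 2 * L) <= 8 * M * A / IZR x).
    { eapply Rle_trans; [|exact HT].
      apply Rmult_le_compat; try lra.
      rewrite <- (Rmult_1_l (IZR x)) at 1; apply Rmult_le_compat_r; nra. }
    apply Rle_div_r in H; [|exact Hx].
    set (N := (125 * M ^ 2) ^ n) in *.
    replace (IZR x ^ 2) with (2 * (IZR x * (/ 2 * L) * IZR x) * N)
      by (replace (2 * (IZR x * (/ 2 * L) * IZR x) * N) with (IZR x ^ 2 * (L * N)) by field;
          rewrite HL; ring).
    replace (16 * M * (A * N)) with (2 * (8 * M * A) * N) by ring.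
    apply Rmult_le_compat_r; lra.
  (* For [x > 16 * M * A] the error is at most 1/2 while [|T| >= 1], so [s1 * s2 * x * |g| >= 1/2];
     the upper bound for [|g|] gives the third alternative. *)
  - destruct (Rle_or_lt (IZR x) (16 * M * A)) as [?|Hxl]; [left; assumption|].
    right; right.
    assert (HT1 : 1 <= Rabs (IZR T)) by (rewrite <- abs_IZR; apply IZR_le; clear - T0; lia).
    assert (8 * M * A / IZR x <= / 2) by (apply Rle_div_l; lra).
    assert (Rabs (IZR T) <= Rabs (IZR T - s1 * s2 * IZR x * g) + Rabs (s1 * s2 * IZR x * g)).
    { eapply Rle_trans; [|apply Rabs_triang]; right; f_equal; ring. }
    rewrite !Rabs_mult, (Rabs_pos_eq s1), (Rabs_pos_eq s2), (Rabs_pos_eq (IZR x)) in H0 by lra.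
    assert (s1 * s2 <= IZR (D1 * D2)) by (rewrite mult_IZR; apply Rmult_le_compat; nra).
    assert (s1 * s2 * IZR x * Rabs g <= IZR (D1 * D2) * IZR x * (M ^ 2 * (16 * K ^ 2 / M ^ 2) ^ n)).
    { apply Rmult_le_compat; auto using Rabs_pos; [|apply Rmult_le_compat_r; lra].
      apply Rmult_le_pos; [apply Rmult_le_pos|]; lra. }
    rewrite !Rmult_assoc in *; lra.
Qed.

(** * Overlapping windows and finiteness *)

Lemma consecutive_bracket (f : nat -> R) (x : R) (N : nat) :
  f 0%nat < x -> x <= f N -> exists j, f j < x <= f (S j).
Proof.
  intros H0; induction N as [|N IH]; intros HN; [lra|].
  destruct (Rle_or_lt x (f N)) as [H|H]; [auto | exists N; split; assumption].
Qed.

(** The window of [q + 1] starts at exponent [25 * q + 26], which is at most [30 * q - 3] exactly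
    when [q >= 6]; so consecutive windows overlap from [q = 6] on, where the first starts at
    exponent 151. *)
Lemma power_bracket (M x : R) : 2 <= M -> M ^ 151 < x ->
  exists q, (6 <= q)%nat /\ M ^ (25 * q + 1) < x <= M ^ (30 * q - 3).
Proof.
  intros HM Hx.
  destruct (Pow_x_infinity M ltac:(rewrite Rabs_pos_eq; lra) x) as (N & HN).
  specialize (HN (25 * (N + 6) + 1)%nat ltac:(lia)).
  rewrite Rabs_pos_eq in HN by (apply pow_le; lra).
  destruct (consecutive_bracket (fun j => M ^ (25 * (j + 6) + 1)) x N)
    as (j & Hj1 & Hj2); [exact Hx | lra |].
  exists (j + 6)%nat; split; [lia|]; split; [exact Hj1|].
  apply Rle_trans with (1 := Hj2); apply Rle_pow; [lra | lia].
Qed.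

(* Taking [n = 16 q] in [pell_window], the factors [C^n] are absorbed into [M^(2 q)]. *)
Lemma window_contradiction (K G M x : R) (q : nat) :
  1 <= K -> 1 <= G <= K -> (4000 * K ^ 2) ^ 8 <= M -> (6 <= q)%nat ->
  M ^ (25 * q + 1) < x <= M ^ (30 * q - 3) ->
  x <= 16 * M * (24 * K ^ 2 * M) ^ (16 * q) \/
  x ^ 2 <= 16 * M * (3000 * K ^ 2 * M ^ 3) ^ (16 * q) \/
  1 <= 2 * G * x * (M ^ 2 * (16 * K ^ 2 / M ^ 2) ^ (16 * q)) -> False.
Proof.
  intros HK HG HM Hq Hx.
  assert (HH : 4000 * K <= 4000 * K ^ 2) by nra.
  assert (HM1 : 4000 * K <= M).
  { apply Rle_trans with (2 := HM); apply Rle_trans with (1 := HH).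
    rewrite <- (pow_1 (4000 * K ^ 2)) at 1; apply Rle_pow; [lra | lia]. }
  (* [M] dominates an eighth power, and [16 * q = 8 * (2 * q)]; the constant 4000 exceeds 24, 3000
     and 16. *)
  assert (Hsmall : forall a, 0 <= a <= 4000 * K ^ 2 -> 0 <= a ^ (16 * q) <= M ^ (2 * q)).
  { intros a Ha; split; [apply pow_le; lra|].
    apply Rle_trans with ((4000 * K ^ 2) ^ (16 * q)); [apply pow_incr; lra|].
    replace (16 * q)%nat with (8 * (2 * q))%nat by lia; rewrite pow_mult.
    apply pow_incr; split; [apply pow_le; lra | exact HM]. }
  assert (Hp : forall k, 0 < M ^ k) by (intros k; apply pow_lt; lra).
  assert (HMM : 16 * M <= M ^ 2) by nra.
  (* Exponents of [M]: the first case needs [18 * q + 2 <= 25 * q + 1]. The second has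
     [50 * q + 2 = 2 * (25 * q + 1)], which fixes the lower end of the window. In the third,
     [2 * G < M] and [1 + (30 * q - 3) + 2 + 2 * q = 32 * q] fix the upper end. *)
  intros [H | [H | H]].
  - apply (Rlt_irrefl x); apply Rle_lt_trans with (1 := H).
    apply Rle_lt_trans with (2 := proj1 Hx).
    rewrite Rpow_mult_distr.
    apply Rle_trans with (M ^ 2 * (M ^ (2 * q) * M ^ (16 * q))).
    + destruct (Hsmall (24 * K ^ 2)); [nra|].
      apply Rmult_le_compat; auto; [lra | | apply Rmult_le_compat_r; auto; left; auto].
      apply Rmult_le_pos; auto; left; auto.
    + rewrite <- !pow_add; apply Rle_pow; [lra | lia].
  - apply (Rlt_irrefl (x ^ 2)); apply Rle_lt_trans with (1 := H).
    apply Rle_lt_trans with ((M ^ (25 * q + 1)) ^ 2).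
    + rewrite Rpow_mult_distr, <- !pow_mult.
      apply Rle_trans with (M ^ 2 * (M ^ (2 * q) * M ^ (3 * (16 * q)))).
      * destruct (Hsmall (3000 * K ^ 2)); [nra|].
        apply Rmult_le_compat; auto; [lra | | apply Rmult_le_compat_r; auto; left; auto].
        apply Rmult_le_pos; auto; left; auto.
      * rewrite <- !pow_add; apply Rle_pow; [lra | lia].
    + specialize (Hp (25 * q + 1)%nat); nra.
  - destruct (Hsmall (16 * K ^ 2)) as [S0 S1]; [nra|].
    unfold Rdiv in H; rewrite Rpow_mult_distr, pow_inv, <- pow_mult in H.
    set (a := (16 * K ^ 2) ^ (16 * q)) in *.
    assert (H' : M ^ (2 * (16 * q)) <= 2 * G * x * (M ^ 2 * a)).
    { replace (2 * G * x * (M ^ 2 * a)) with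
        (2 * G * x * (M ^ 2 * (a * / M ^ (2 * (16 * q)))) * M ^ (2 * (16 * q)))
        by (field; apply Rgt_not_eq, Hp).
      rewrite <- (Rmult_1_l (M ^ (2 * (16 * q)))) at 1.
      apply Rmult_le_compat_r; [left; auto | exact H]. }
    assert (Hx0 : 0 < x) by (pose proof (Hp (25 * q + 1)%nat); lra).
    assert (2 * G * x * (M ^ 2 * a) < M * M ^ (30 * q - 3) * (M ^ 2 * M ^ (2 * q))).
    { pose proof (Hp 2%nat); pose proof (Hp (2 * q)%nat); pose proof (Hp (30 * q - 3)%nat).
      apply Rle_lt_trans with (2 * G * M ^ (30 * q - 3) * (M ^ 2 * M ^ (2 * q))).
      - apply Rmult_le_compat; [| | |apply Rmult_le_compat_l; lra]; try nra.
      - apply Rmult_lt_compat_r; [nra|]; apply Rmult_lt_compat_r; lra. }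
    rewrite (tech_pow_Rmult M), <- !pow_add in H0.
    replace (S (30 * q - 3) + (2 + 2 * q))%nat with (2 * (16 * q))%nat in H0 by lia.
    lra.
Qed.

(** If no solution has [x >= B0], then [B0] is a bound. Otherwise one such solution serves as
    expansion point and excludes every [|x| > M ^ 151]. The bound is ineffective: which case holds
    is decided by excluded middle. *)
Theorem simultaneous_pell_finite (D1 D2 : Z) :
  (0 < D1)%Z -> (0 < D2)%Z -> D1 <> D2 ->
  exists B : Z, forall x y z e1 e2 : Z,
    Z.abs e1 = 4%Z -> Z.abs e2 = 4%Z ->
    (D1 * x ^ 2 + e1 = y ^ 2)%Z -> (D2 * x ^ 2 + e2 = z ^ 2)%Z -> (Z.abs x <= B)%Z.
Proof.
  intros HD1 HD2 HD12.
  set (K := (64 * D1 * D2 * (D1 + D2))%Z).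
  (* With [x0 >= B0], the summand [P] makes [M] large enough to absorb constants, and
     [12 * (D1 + D2)] keeps the [u_j] comparable. *)
  set (P := ((4000 * K ^ 2) ^ 8)%Z); set (B0 := (P + 12 * (D1 + D2))%Z).
  assert (Hsqr : forall a, (Z.abs a ^ 2 = a ^ 2)%Z)
    by (intros a; rewrite <- Z.pow_even_abs; [reflexivity | exists 1%Z; reflexivity]).
  destruct (classic (exists x y z e1 e2 : Z, (B0 <= x)%Z /\ (0 <= y)%Z /\ (0 <= z)%Z /\
    Z.abs e1 = 4%Z /\ Z.abs e2 = 4%Z /\
    (D1 * x ^ 2 + e1 = y ^ 2)%Z /\ (D2 * x ^ 2 + e2 = z ^ 2)%Z))
    as [(x0 & y0 & z0 & e1 & e2 & Hx0 & Hy0 & Hz0 & He1 & He2 & E1 & E2) | Hno].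
  - set (M := (D1 * D2 * x0 ^ 2 + 4 * (D1 + D2))%Z).
    assert (HK : (D1 * D2 <= K)%Z) by (unfold K; clear - HD1 HD2; nia).
    assert (HG : (1 <= D1 * D2)%Z) by (clear - HD1 HD2; nia).
    assert (HH : (0 <= P)%Z) by (apply Z.pow_nonneg; clear - HK HG; nia).
    assert (Hx0p : (0 < x0)%Z) by (unfold B0 in Hx0; clearbody P; clear - Hx0 HH HD1 HD2; lia).
    assert (Hsq : (x0 <= D1 * D2 * x0 ^ 2)%Z) by (clear - HG Hx0p; nia).
    assert (HM : (P <= M)%Z)
      by (unfold M, B0 in *; clearbody P; clear - Hx0 Hsq HD1 HD2; lia).
    assert (Hlarge : (12 * (D1 + D2) <= D1 * D2 * x0 ^ 2)%Z)
      by (unfold B0 in *; clearbody P; clear - Hx0 Hsq HH; lia).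
    assert (HM2 : 2 <= IZR M) by (apply IZR_le; unfold M; clear - Hsq HD1 HD2 Hx0p; lia).
    exists (M ^ 151)%Z; intros x y z f1 f2 Hf1 Hf2 F1 F2.
    apply Z.le_ngt; intros Hlt; apply IZR_lt in Hlt.
    change 151%Z with (Z.of_nat 151) in Hlt; rewrite <- pow_IZR in Hlt.
    destruct (power_bracket _ _ HM2 Hlt) as (q & Hq & Hxq).
    apply (window_contradiction (IZR K) (IZR (D1 * D2)) (IZR M) (IZR (Z.abs x)) q); auto.
    + apply IZR_le; clear - HK HG; lia.
    + split; apply IZR_le; assumption.
    + apply IZR_le in HM; unfold P in HM.
      change 8%Z with (Z.of_nat 8) in HM; change 2%Z with (Z.of_nat 2) in HM.
      rewrite <- pow_IZR, mult_IZR, <- pow_IZR in HM; exact HM.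
    + assert (Hx : (0 < Z.abs x)%Z) by (apply lt_IZR; pose proof (pow_lt (IZR M) 151); lra).
      assert (Hn : (0 < 16 * q)%nat) by (clear - Hq; lia).
      apply (pell_window D1 D2 x0 y0 z0 e1 e2 (Z.abs x) (Z.abs y) (Z.abs z) f1 f2);
        rewrite ?Hsqr; auto using Z.abs_nonneg.
  - exists B0; intros x y z f1 f2 Hf1 Hf2 F1 F2.
    apply Z.le_ngt; intros Hlt; apply Hno.
    exists (Z.abs x), (Z.abs y), (Z.abs z), f1, f2; rewrite !Hsqr.
    repeat split; auto using Z.abs_nonneg, Z.lt_le_incl.
Qed.

End Approximation.

(** * Lucas sequences and their discriminants *)

Lemma lucasU_rec (P Q : Z) (n : nat) :
  lucasU P Q (S (S n)) = P * lucasU P Q (S n) - Q * lucasU P Q n.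
Proof. unfold lucasU; simpl; destruct (lucasU_pair P Q n); reflexivity. Qed.

(** The form [X^2 - P X Y + Q Y^2] is multiplied by [Q] under the recurrence step from [(X, Y)] to
    [(P X - Q Y, X)]. *)
Lemma lucasU_norm (P Q : Z) (n : nat) :
  lucasU P Q (S n) ^ 2 - P * lucasU P Q (S n) * lucasU P Q n + Q * lucasU P Q n ^ 2
    = Q ^ Z.of_nat n.
Proof.
  induction n as [|n IH]; [change (1 ^ 2 - P * 1 * 0 + Q * 0 ^ 2 = 1); ring|].
  rewrite Nat2Z.inj_succ, Z.pow_succ_r, <- IH, lucasU_rec by lia; ring.
Qed.

Lemma inU_discriminant (P Q x : Z) : Z.abs Q = 1 -> inU P Q x ->
  exists e y, Z.abs e = 4 /\ (P ^ 2 - 4 * Q) * x ^ 2 + e = y ^ 2.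
Proof.
  intros HQ (n & <-).
  (* The second witness is [V_n = 2 U_{n+1} - P U_n]. *)
  exists (4 * Q ^ Z.of_nat n), (2 * lucasU P Q (S n) - P * lucasU P Q n); split.
  - rewrite Z.abs_mul, Z.abs_pow, HQ, Z.pow_1_l by lia; reflexivity.
  - rewrite <- (lucasU_norm P); ring.
Qed.

Lemma discriminant_pos (P Q : Z) : ~ degenerate P Q -> 0 < P -> Z.abs Q = 1 ->
  0 < P ^ 2 - 4 * Q.
Proof.
  unfold degenerate; intros Hd HP HQ.
  assert (HQ' : Q = 1 \/ Q = -1) by lia; destruct HQ' as [-> | ->]; [|nia].
  assert (P <> 1) by (intros ->; tauto).
  assert (P <> 2) by (intros ->; tauto).
  nia.
Qed.

Lemma discriminant_eq (P1 Q1 P2 Q2 : Z) :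
  (P1, Q1) <> (P2, Q2) -> 0 < P1 -> 0 < P2 -> Z.abs Q1 = 1 -> Z.abs Q2 = 1 ->
  P1 ^ 2 - 4 * Q1 = P2 ^ 2 - 4 * Q2 ->
  ((P1, Q1) = (1, -1) /\ (P2, Q2) = (3, 1)) \/ ((P1, Q1) = (3, 1) /\ (P2, Q2) = (1, -1)).
Proof.
  intros Hne HP1 HP2 HQ1 HQ2 E.
  assert (H1 : Q1 = 1 \/ Q1 = -1) by lia; assert (H2 : Q2 = 1 \/ Q2 = -1) by lia.
  (* Here [a^2 - b^2 = 8]. Parity excludes [b = a - 1], so [b <= a - 2], hence [4 a - 4 <= 8]. *)
  assert (Hgap : forall a b, 0 < a -> 0 < b -> a ^ 2 - 4 * 1 = b ^ 2 - 4 * -1 -> a = 3 /\ b = 1).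
  { intros a b Ha Hb Hab.
    assert (b < a) by nia; assert (b <> a - 1) by nia; assert (a <= 3) by nia.
    assert (b = 1) by nia; subst b; split; nia. }
  assert (Heq : P1 ^ 2 = P2 ^ 2 -> P1 = P2) by nia.
  destruct H1 as [-> | ->]; destruct H2 as [-> | ->].
  - exfalso; apply Hne; f_equal; apply Heq; lia.
  - right; destruct (Hgap P1 P2) as [-> ->]; auto.
  - left; destruct (Hgap P2 P1) as [-> ->]; auto.
  - exfalso; apply Hne; f_equal; apply Heq; lia.
Qed.

Lemma infinite_Z_unbounded (S : Z -> Prop) :
  infinite_Z S <-> forall B, exists x, S x /\ B < Z.abs x.
Proof.
  split.
  - intros Hinf B; apply NNPP; intros Hno; apply Hinf.
    (* The list of all integers from [-B] to [B]. *)
    exists (map (fun k => Z.of_nat k - B) (seq 0 (Z.to_nat (2 * B + 1)))).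
    intros x Hx; apply in_map_iff; exists (Z.to_nat (x + B)).
    assert (~ B < Z.abs x) by (intros H; apply Hno; exists x; auto).
    split; [lia | apply in_seq; lia].
  - intros Hunb (l & Hl).
    assert (Hmax : exists B, forall x, In x l -> Z.abs x <= B).
    { clear; induction l as [|a l (B & IH)].
      - exists 0; intros x [].
      - exists (Z.max (Z.abs a) B); intros x [-> | Hx]; [lia|].
        specialize (IH x Hx); lia. }
    destruct Hmax as (B & HB); destruct (Hunb B) as (x & Hx & Hlt).
    specialize (HB x (Hl x Hx)); lia.
Qed.

(** Fibonacci numbers of even index satisfy [F_{m+4} = 3 F_{m+2} - F_m]; two consecutive values are
    carried through the induction. *)
Lemma lucasU_3_1_double (n : nat) : lucasU 3 1 n = lucasU 1 (-1) (2 * n).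
Proof.
  assert (H : lucasU 3 1 n = lucasU 1 (-1) (2 * n) /\
              lucasU 3 1 (S n) = lucasU 1 (-1) (S (S (2 * n)))).
  { induction n as [|n [IH1 IH2]]; [split; reflexivity|].
    replace (2 * S n)%nat with (S (S (2 * n))) by lia.
    split; [exact IH2|].
    rewrite lucasU_rec, IH1, IH2, !lucasU_rec; ring. }
  apply H.
Qed.

Lemma inU_3_1_fibonacci (x : Z) : inU 3 1 x -> inU 1 (-1) x.
Proof. intros (n & <-); exists (2 * n)%nat; symmetry; apply lucasU_3_1_double. Qed.

Lemma lucasU_3_1_ge (n : nat) : Z.of_nat n <= lucasU 3 1 n.
Proof.
  assert (H : Z.of_nat n <= lucasU 3 1 n /\ lucasU 3 1 n + 1 <= lucasU 3 1 (S n)).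
  { induction n as [|n [IH1 IH2]]; [split; discriminate|].
    rewrite lucasU_rec; lia. }
  apply H.
Qed.

Theorem theorem7 (P1 Q1 P2 Q2 : Z) :
  (P1, Q1) <> (P2, Q2) ->
  ~ degenerate P1 Q1 -> ~ degenerate P2 Q2 ->
  0 < P1 -> 0 < P2 -> Z.abs Q1 = 1 -> Z.abs Q2 = 1 ->
  ((infinite_Z (fun x => inU P1 Q1 x /\ inU P2 Q2 x) <->
      P1 ^ 2 - 4 * Q1 = P2 ^ 2 - 4 * Q2)
   /\ (P1 ^ 2 - 4 * Q1 = P2 ^ 2 - 4 * Q2 <->
      ((P1, Q1) = (1, -1) /\ (P2, Q2) = (3, 1)) \/
      ((P1, Q1) = (3, 1) /\ (P2, Q2) = (1, -1))))
  /\ (infinite_Z (fun x => inU P1 Q1 x /\ inU P2 Q2 x) ->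
      forall x, (inU P1 Q1 x /\ inU P2 Q2 x) <-> inU 3 1 x).
Proof.
  intros Hne Hd1 Hd2 HP1 HP2 HQ1 HQ2.
  assert (Hfin : infinite_Z (fun x => inU P1 Q1 x /\ inU P2 Q2 x) ->
                 P1 ^ 2 - 4 * Q1 = P2 ^ 2 - 4 * Q2).
  { intros Hinf; apply NNPP; intros HD.
    destruct (simultaneous_pell_finite _ _ (discriminant_pos P1 Q1 Hd1 HP1 HQ1)
                (discriminant_pos P2 Q2 Hd2 HP2 HQ2) HD) as (B & HB).
    destruct (proj1 (infinite_Z_unbounded _) Hinf B) as (x & [H1 H2] & Hlt).
    destruct (inU_discriminant _ _ _ HQ1 H1) as (e1 & y & He1 & E1).
    destruct (inU_discriminant _ _ _ HQ2 H2) as (e2 & z & He2 & E2).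
    specialize (HB x y z e1 e2 He1 He2 E1 E2); lia. }
  assert (Hpairs := discriminant_eq P1 Q1 P2 Q2 Hne HP1 HP2 HQ1 HQ2).
  assert (Hinter : P1 ^ 2 - 4 * Q1 = P2 ^ 2 - 4 * Q2 ->
                   forall x, (inU P1 Q1 x /\ inU P2 Q2 x) <-> inU 3 1 x).
  { intros E x; pose proof (inU_3_1_fibonacci x) as Hfib.
    destruct (Hpairs E) as [[[= -> ->] [= -> ->]] | [[= -> ->] [= -> ->]]]; tauto. }
  split; [split; split|].
  - exact Hfin.
  - intros E; apply infinite_Z_unbounded; intros B.
    (* For [B < 0] the index and the term are 0, which still exceeds [B]. *)
    exists (lucasU 3 1 (Z.to_nat (B + 1))); split.
    + apply (Hinter E); exists (Z.to_nat (B + 1)); reflexivity.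
    + pose proof (lucasU_3_1_ge (Z.to_nat (B + 1))); lia.
  - exact Hpairs.
  - intros [[[= -> ->] [= -> ->]] | [[= -> ->] [= -> ->]]]; reflexivity.
  - intros Hinf; apply Hinter, Hfin, Hinf.
Qed.
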